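(* Let $n\ge 3$ and let $M^n$ be an $n$-dimensional complete, connected, smooth Riemannian manifold without boundary, with metric $\langle\,,\rangle$, and suppose $M^n$ is isometric to a Riemannian product $N\times\mathbb{R}$. Let $f:M^n\to\mathbb{R}$ be a non-trivial affine function, and let $\alpha:I\subset\mathbb{R}\to M^n$ be a Frenet curve of proper $n$ with harmonic curvatures $\{H_1,\dots,H_{n-2}\}$. If $\alpha$ is an $f$-eikonal helix curve, then $H_{n-2}\neq 0$ and $H_1^2+H_2^2+\dots+H_{n-2}^2$ is a non-zero constant.
   Context: A smooth curve $\alpha=\alpha(s):I\to M^n$ ($I\subset\mathbb{R}$ an interval), parametrized by arc length, is a Frenet curve of proper $n$ if there are orthonormal frame fields $\{V_1=\alpha',V_2,\dots,V_n\}$ along $\alpha$ (the Frenet frame) and positive functions $k_1(s),\dots,k_{n-1}(s)$ (the curvatures) with $$\nabla_{\alpha'}V_i=-k_{i-1}V_{i-1}+k_iV_{i+1},\qquad i=1,\dots,n,$$ where $V_0=V_{n+1}=0$ and $\nabla_{\alpha'}$ is the Riemannian (Levi-Civita) connection along $\alpha$. Harmonic curvatures $H_i:I\to\mathbb{R}$ of $\alpha$, $i=1,\dots,n-2$: with the convention $H_0=0$, $$H_1=\frac{k_1}{k_2},\qquad H_i=\frac{1}{k_{i+1}}\left\{V_1[H_{i-1}]+k_iH_{i-2}\right\}\quad(2\le i\le n-2),$$ where $V_1[H]=H'=dH/ds$. $\nabla f$ is the gradient of the function $f$: $df(X)=\langle\nabla f,X\rangle$. A Frenet curve $\alpha$ is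 an $f$-eikonal helix curve, with axis $\nabla f$, if $\|\nabla f\|$ is constant along $\alpha$ and the function $\langle\nabla f,V_1\rangle$ is a non-zero constant along $\alpha$. A function $f:M^n\to\mathbb{R}$ is affine if for every geodesic $\gamma$ of $M^n$ (with affine parameter $t$) the function $t\mapsto f(\gamma(t))$ is of the form $at+b$ with $a,b$ real constants; it is non-trivial if it is not constant. *)

(* Defs.v *)
From HB Require Import structures.
From mathcomp Require Import all_boot all_order all_algebra.
From mathcomp Require Import lra.
From mathcomp Require Import all_classical all_reals all_analysis.
Set Implicit Arguments.
Unset Strict Implicit.
Unset Printing Implicit Defensive.
Import Order.TTheory GRing.Theory Num.Theory numFieldNormedType.Exports.
Local Open Scope classical_set_scope.
Local Open Scope ring_scope.

(* Class C^k on a set U, which is always open below.  The model spaces being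
   finite dimensional, it is enough that every directional derivative of a
   differentiable map be of class C^(k-1). *)
Fixpoint Ck (R : realType) (E F : normedModType R) (k : nat) (U : set E)
    (f : E -> F) : Prop :=
  match k with
  | 0 => forall x, U x -> {for x, continuous f}
  | k'.+1 => (forall x, U x -> differentiable f x) /\
             (forall v : E, Ck k' U (fun x => 'D_v f x))
  end.

Definition smooth_on (R : realType) (E F : normedModType R) (U : set E)
  (f : E -> F) : Prop := forall k, Ck k U f.

(* The intervals on which curves are defined may contain their end points:
   derivatives are taken within the interval, hence are one-sided there. *)
Definition proper_interval (R : realType) (I : set R) : Prop :=
  is_interval I /\ exists a b, [/\ I a, I b & a < b].

Definition diff_quot (R : realType) (F : normedModType R) (f : R -> F)
  (t u : R) : F := (u - t)^-1 *: (f u - f t).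

Definition is_derive_in (R : realType) (F : normedModType R) (I : set R)
    (f : R -> F) (t : R) (l : F) : Prop :=
  diff_quot f t u @[u --> within I t^'] --> l.

Definition derive_in (R : realType) (F : normedModType R) (I : set R)
    (f : R -> F) (t : R) : F :=
  lim (diff_quot f t u @[u --> within I t^']).

Definition smooth_in (R : realType) (F : normedModType R) (J : set R)
    (f : R -> F) : Prop :=
  exists D : nat -> R -> F, D 0%N = f /\
    forall k t, J t -> is_derive_in J (D k) t (D k.+1 t).

(* Data of a manifold modelled on E: an atlas indexed by [chart], each chart c
   being a bijection [coord c] from [dom c] onto its image, with inverse
   [point c]; a preferred chart around every point; and a metric tensor, read
   in each chart: [metric c x u v] is g_x(u, v) for x in the image of c. *)
Record metricAtlas (R : realType) (E : normedModType R) := MetricAtlas {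
  carrier :> topologicalType;
  chart : Type;
  dom : chart -> set carrier;
  coord : chart -> carrier -> E;
  point : chart -> E -> carrier;
  chart_at : carrier -> chart;
  metric : chart -> E -> E -> E -> R
}.

Arguments chart {R E} m.
Arguments dom {R E m} c _.
Arguments coord {R E m} c p.
Arguments point {R E m} c x.
Arguments chart_at {R E m} p.
Arguments metric {R E m} c x u v.

Section Manifold.
Context {R : realType} {E : normedModType R}.
Implicit Type M : metricAtlas E.

Definition chart_im M (c : chart M) : set E := coord c @` dom c.

Definition transition M (c d : chart M) : E -> E := fun x => coord d (point c x).

Record smooth_manifold M : Prop := {
  manifold_hausdorff : hausdorff_space M;
  manifold_second_countable : @second_countable M;
  chart_at_dom : forall p : M, dom (chart_at p) p;
  dom_open : forall c : chart M, open (dom c);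
  chart_im_open : forall c : chart M, open (chart_im c);
  coordK : forall (c : chart M) p, dom c p -> point c (coord c p) = p;
  coord_continuous : forall (c : chart M) p, dom c p ->
    {for p, continuous (coord c)};
  point_continuous : forall (c : chart M) x, chart_im c x ->
    {for x, continuous (point c)};
  transition_smooth : forall c d : chart M,
    smooth_on (coord c @` (dom c `&` dom d)) (transition c d)
}.

Record riemannian_manifold M : Prop := {
  riemannian_smooth :> smooth_manifold M;
  metric_linear : forall (c : chart M) x, chart_im c x ->
    forall (a : R) (u v w : E),
    metric c x (a *: u + v) w = a * metric c x u w + metric c x v w;
  metric_sym : forall (c : chart M) x, chart_im c x ->
    forall u v : E, metric c x u v = metric c x v u;
  metric_pos : forall (c : chart M) x, chart_im c x ->
    forall u : E, u != 0 -> 0 < metric c x u u;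
  metric_smooth : forall (c : chart M) (u v : E),
    smooth_on (chart_im c) (fun x => metric c x u v);
  metric_transition : forall (c d : chart M) p, dom c p -> dom d p ->
    forall u v : E,
    metric c (coord c p) u v =
    metric d (coord d p) ('D_u (transition c d) (coord c p))
                         ('D_v (transition c d) (coord c p))
}.

(* A tangent vector at p is the family of its components in all the charts
   around p, related by the derivatives of the transition maps; its values at
   the other charts are irrelevant. *)
Definition tvec M := chart M -> E.

Definition tangent M (p : M) (v : tvec M) : Prop :=
  forall c d : chart M, dom c p -> dom d p ->
  v d = 'D_(v c) (transition c d) (coord c p).

Definition inner M (p : M) (u v : tvec M) : R :=
  let c := chart_at p in metric c (coord c p) (u c) (v c).

Definition tnorm M (p : M) (v : tvec M) : R := Num.sqrt (inner p v v).

Definition smooth_fun M (f : M -> R) : Prop :=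
  forall c : chart M, smooth_on (chart_im c) (f \o point c).

Definition dfun M (f : M -> R) (p : M) (v : tvec M) : R :=
  let c := chart_at p in 'D_(v c) (f \o point c) (coord c p).

Definition is_gradient M (f : M -> R) (G : M -> tvec M) : Prop :=
  forall p : M, tangent p (G p) /\
    forall v : tvec M, tangent p v -> dfun f p v = inner p (G p) v.

Definition smooth_curve M (I : set R) (al : R -> M) : Prop :=
  {within I, continuous al} /\
  forall c : chart M,
    smooth_in [set t | I t /\ dom c (al t)] (fun t => coord c (al t)).

Definition is_velocity M (I : set R) (al : R -> M) (t : R) (v : tvec M) :=
  forall c : chart M, dom c (al t) ->
  is_derive_in I (fun s => coord c (al s)) t (v c).

(* Christoffel symbols of the first kind: g_x(nabla_u v, w) for the constant
   fields u, v, w of the chart c.  [christoffelP] below shows that they are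
   the symbols of the only torsion-free connection compatible with g. *)
Definition christoffel M (c : chart M) (x u v w : E) : R :=
  2^-1 * ('D_u (fun y => metric c y v w) x + 'D_v (fun y => metric c y u w) x
          - 'D_w (fun y => metric c y u v) x).

(* [is_covder I al V t W]: the covariant derivative at time t of the vector
   field V along the curve al is W.  In a chart, W = V' + Gamma(al', V), where
   Gamma is given by its inner products with all vectors. *)
Definition is_covder M (I : set R) (al : R -> M) (V : R -> tvec M) (t : R)
    (W : tvec M) : Prop :=
  forall c : chart M, dom c (al t) ->
  exists dx dV : E,
  [/\ is_derive_in I (fun s => coord c (al s)) t dx,
      is_derive_in I (fun s => V s c) t dV &
      forall w : E, metric c (coord c (al t)) (W c - dV) w =
                    christoffel c (coord c (al t)) dx (V t c) w].

Definition geodesic M (I : set R) (ga : R -> M) : Prop :=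
  smooth_curve I ga /\
  exists v : R -> tvec M, forall t, I t ->
    is_velocity I ga t (v t) /\ is_covder I ga v t (fun=> 0).

(* The exponential map is defined on the whole tangent bundle. *)
Definition geodesically_complete M : Prop :=
  forall (p : M) (v : tvec M), tangent p v ->
  exists ga : R -> M,
  [/\ geodesic setT ga, ga 0 = p & is_velocity setT ga 0 v].

Definition affine_fun M (f : M -> R) : Prop :=
  forall (J : set R) (ga : R -> M), proper_interval J -> geodesic J ga ->
  exists a b : R, forall t, J t -> f (ga t) = a * t + b.

(* V 1, ..., V n is the Frenet frame and k 1, ..., k n.-1 the curvatures; k 0
   and k n are multiplied by zero vectors. *)
Record frenet_curve M (n : nat) (I : set R) (al : R -> M)
    (V : nat -> R -> tvec M) (k : nat -> R -> R) : Prop := {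
  frenet_interval : proper_interval I;
  frenet_smooth : smooth_curve I al;
  frenet_tangent : forall i t, (0 < i <= n)%N -> I t -> tangent (al t) (V i t);
  frenet_orthonormal : forall i j t, (0 < i <= n)%N -> (0 < j <= n)%N -> I t ->
    inner (al t) (V i t) (V j t) = (i == j)%:R;
  frenet_velocity : forall t, I t -> is_velocity I al t (V 1%N t);
  frenet_first : forall t c, V 0%N t c = 0;
  frenet_last : forall t c, V n.+1 t c = 0;
  frenet_curvature : forall i t, (0 < i < n)%N -> I t -> 0 < k i t;
  frenet_eq : forall i t, (0 < i <= n)%N -> I t ->
    is_covder I al (V i) t
      (fun c => - k i.-1 t *: V i.-1 t c + k i t *: V i.+1 t c)
}.

(* al is an f-eikonal helix with unit tangent T. *)
Definition eikonal_helix M (I : set R) (f : M -> R) (al : R -> M)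
    (T : R -> tvec M) : Prop :=
  exists G : M -> tvec M, is_gradient f G /\
  (exists a : R, forall t, I t -> tnorm (al t) (G (al t)) = a) /\
  (exists b : R, b != 0 /\ forall t, I t -> inner (al t) (G (al t)) (T t) = b).

End Manifold.

Fixpoint harmonic_curvature (R : realType) (I : set R) (k : nat -> R -> R)
    (i : nat) : R -> R :=
  match i with
  | 0 => fun=> 0
  | i'.+1 => match i' with
    | 0 => fun t => k 1%N t / k 2%N t
    | i''.+1 => fun t =>
        (k i.+1 t)^-1 * (derive_in I (harmonic_curvature I k i') t
                         + k i t * harmonic_curvature I k i'' t)
    end
  end.

Definition smooth_map (R : realType) (E F : normedModType R)
    (M : metricAtlas E) (N : metricAtlas F) (h : M -> N) :=
  continuous h /\
  forall (c : chart M) (d : chart N),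
    smooth_on (coord c @` (dom c `&` h @^-1` dom d))
              (fun x => coord d (h (point c x))).

Definition pushforward (R : realType) (E F : normedModType R)
    (M : metricAtlas E) (N : metricAtlas F) (h : M -> N)
    (p : M) (v : tvec M) : tvec N :=
  let c := chart_at p in
  fun d => 'D_(v c) (fun x => coord d (h (point c x))) (coord c p).

Definition isometric (R : realType) (E F : normedModType R)
    (M : metricAtlas E) (N : metricAtlas F) : Prop :=
  exists (h : M -> N) (h' : N -> M),
  [/\ cancel h h' /\ cancel h' h, smooth_map h, smooth_map h' &
      forall (p : M) (u v : tvec M), tangent p u -> tangent p v ->
      inner (h p) (pushforward h p u) (pushforward h p v) = inner p u v].

Definition riemannian_product (R : realType) (E F : normedModType R)
    (M : metricAtlas E) (N : metricAtlas F) :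
    metricAtlas (E * F)%type :=
  @MetricAtlas R (E * F)%type (M * N)%type (chart M * chart N)%type
    (fun c => dom c.1 `*` dom c.2)
    (fun c p => (coord c.1 p.1, coord c.2 p.2))
    (fun c x => (point c.1 x.1, point c.2 x.2))
    (fun p => (chart_at p.1, chart_at p.2))
    (fun c x u v => metric c.1 x.1 u.1 v.1 + metric c.2 x.2 u.2 v.2).

Definition real_line (R : realType) : metricAtlas R :=
  @MetricAtlas R R R unit (fun=> setT) (fun=> id) (fun=> id) (fun=> tt)
    (fun _ _ u v => u * v).

(* For A u v w = g_x(nabla_u v, w): torsion-freeness and compatibility with g
   characterize the Christoffel symbols. *)
Lemma christoffelP (R : realType) (E : normedModType R) (M : metricAtlas E)
    (c : chart M) (x : E) (A : E -> E -> E -> R) :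
  riemannian_manifold M -> chart_im c x ->
  ((forall u v w, A u v w = A v u w) /\
   (forall u v w, 'D_u (fun y => metric c y v w) x = A u v w + A u w v)) <->
  (forall u v w, A u v w = christoffel c x u v w).
Proof.
move=> hM cx.
have gC u v w :
    'D_u (fun y => metric c y v w) x = 'D_u (fun y => metric c y w v) x.
  apply: near_eq_derive; near=> y; apply: (metric_sym hM).
  by near: y; apply: open_nbhs_nbhs; split => //; exact: (chart_im_open hM).
split=> [[Asym Ag] u v w|AE]; last split=> u v w.
- rewrite /christoffel !Ag (Asym w u v) (Asym w v u) (Asym v u w).
  by lra.
- by rewrite !AE /christoffel (gC w u v); lra.
- by rewrite !AE /christoffel (gC u w v) (gC w u v); lra.
Unshelve. all: by end_near. Qed.

(* Main.v *)
Require Import Defs.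
From HB Require Import structures.
From mathcomp Require Import all_boot all_order all_algebra.
From mathcomp Require Import lra ring.
From mathcomp Require Import all_classical all_reals all_analysis.
Import Order.TTheory GRing.Theory Num.Theory numFieldNormedType.Exports.
(* Restores [coord] and [point] to their meaning for charts. *)
Import Defs.
Set Implicit Arguments.
Unset Strict Implicit.
Unset Printing Implicit Defensive.
Local Open Scope classical_set_scope.
Local Open Scope ring_scope.

(** An affine function has a parallel gradient, and everything follows by
reading a parallel field in the Frenet frame.

Parallelism. Let [F] be [f] in a chart, and let a geodesic [x] leave a point
with velocity [u], which completeness provides. Differentiating the affine
function [F (x s)] twice gives 0 = D_u D_u F + DF(x''), while the geodesic
equation says g(- x'', w) = Gamma(u, u, w) for every w.  Since DF is the inner
product with the gradient [G], D_u D_u F = Gamma(u, u, G).  Both sides are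
quadratic forms in u; the left one comes from a symmetric bilinear form by
the symmetry of second derivatives ([derive_sym]), the right one by the
symmetry of the metric, so the equality polarizes ([affine_hessian]).  The
covariant derivative of [G] therefore vanishes, in the form that is needed
along a curve: the derivative of <G, V> is <G, DV/dt>
([gradient_component_derive]).

Components. Put a_i = <G, V_i>.  The Frenet equations become
a_i' = - k_(i-1) a_(i-1) + k_i a_(i+1), with a_1 = b a non-zero constant.
Solving for a_(i+1) from the first equation onwards, a_2 = 0 and then
a_(i+2) = b H_i, since this is the recurrence that defines the harmonic
curvatures ([component_harmonic]).  Solving instead for a_(i-1) from the last
equation downwards shows that a_n = b H_(n-2) cannot vanish identically, as b
would then be 0 ([last_component_neq0]).

Norm. The frame is orthonormal, hence a basis, so that
|G|^2 = b^2 + 0 + b^2 (H_1^2 + ... + H_(n-2)^2) ([orthonormal_parseval]).  The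
left-hand side is constant, so the sum of squares is too, and it is at least
H_1^2 = (k_1 / k_2)^2 > 0. *)

(** * Derivatives within an interval *)

Section DeriveIn.
Context {R : realType}.
Implicit Types (E F : normedModType R) (I : set R) (t : R).

(** The form without division is the one that composes: it makes sense where
the inner function of a composite takes the same value twice. *)
Lemma is_derive_in_littleo F I (f : R -> F) t l :
  is_derive_in I f t l <->
  forall e : R, 0 < e -> \forall u \near within I t^',
    `|f u - f t - (u - t) *: l| <= e * `|u - t|.
Proof.
have ut u : u != t -> 0 < `|u - t| by rewrite normr_gt0 subr_eq0.
have key u : u != t ->
    `|l - diff_quot f t u| = `|f u - f t - (u - t) *: l| / `|u - t|.
  move=> nut; rewrite mulrC -normfV -normrZ distrC /diff_quot.
  rewrite [in RHS]scalerBr scalerA mulVf ?subr_eq0// scale1r.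
  by [].
split=> [fl e e0|fl].
  have /cvgrPdist_le/(_ _ e0) := fl.
  rewrite !near_withinE; apply: filterS2 (nbhs_dnbhs_neq t) => u nut.
  by move=> le Iu; rewrite -ler_pdivrMr ?ut// -key//; exact: le.
apply/cvgrPdist_le => e e0; have := fl _ e0.
rewrite !near_withinE; apply: filterS2 (nbhs_dnbhs_neq t) => u nut.
by move=> le Iu; rewrite key// ler_pdivrMr ?ut//; exact: le.
Qed.

Lemma is_derive_in_continuous F I (f : R -> F) t l :
  is_derive_in I f t l -> f u @[u --> within I t^'] --> f t.
Proof.
move=> fl; apply/cvgrPdist_le => e e0.
have /is_derive_in_littleo/(_ 1 ltr01) fo := fl.
have c0 : 0 < e / (1 + `|l|) by rewrite divr_gt0// ltr_pwDl.
have ct : \forall u \near within I t^', `|u - t| <= e / (1 + `|l|).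
  apply: cvg_within; apply: nbhs_dnbhs.
  apply/nbhs_ballP; exists (e / (1 + `|l|)) => //= u.
  by rewrite /ball/= distrC => /ltW.
apply: filterS2 fo ct => u fo; rewrite ler_pdivlMr ?ltr_pwDl// => ct.
rewrite distrC; apply: le_trans ct; rewrite mulrDr mulr1 -normrZ.
rewrite mul1r in fo; apply: le_trans (lerD fo (lexx _)).
by apply: le_trans (ler_normD _ _); rewrite subrK.
Qed.

Lemma is_derive_in_comp E F I (x : R -> E) (g : E -> F) t l :
  differentiable g (x t) -> is_derive_in I x t l ->
  is_derive_in I (g \o x) t ('D_l g (x t)).
Proof.
move=> dg xl; rewrite deriveE//; apply/is_derive_in_littleo => e e0.
have [M M0 gM] : exists2 M, 0 < M & forall v, `|'d g (x t) v| <= M * `|v|.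
  have : {for 0, continuous ('d g (x t))} by exact: diff_continuous.
  move=> /(continuous_linear_bounded 0)/linear_boundedP/pinfty_ex_gt0 [M M0 ?].
  by exists M.
pose c := e / (1 + M + `|l|).
have d0 : 0 < 1 + M + `|l| by rewrite ltr_pwDl// addr_gt0.
have c0 : 0 < c by rewrite divr_gt0.
pose c1 := Num.min c 1.
(* The cap at 1 keeps |x u - x t| at most (1 + |l|) |u - t|. *)
have c10 : 0 < c1 by rewrite lt_min c0 ltr01.
have /is_derive_in_littleo/(_ _ c10) xo := xl.
have go : \forall u \near within I t^',
    `|g (x u) - g (x t) - 'd g (x t) (x u - x t)| <= c * `|x u - x t|.
  have := is_derive_in_continuous xl.
  suff : \forall y \near x t,
     `|g y - g (x t) - 'd g (x t) (y - x t)| <= c * `|y - x t|.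
    by move=> gx xc; exact: (xc _ gx).
  have /diff_locallyP[_ /eqaddoP/(_ _ c0)] := dg.
  rewrite (near_shift 0 (x t)) /= => h1.
  by apply: filterS h1 => y /=; rewrite !fctE /= subr0 addrK opprD addrA.
apply: filterS2 xo go => u xo go.
have -> : (g \o x) u - (g \o x) t - (u - t) *: 'd g (x t) l =
  (g (x u) - g (x t) - 'd g (x t) (x u - x t)) +
  'd g (x t) (x u - x t - (u - t) *: l).
  by rewrite [in X in _ = _ + X]linearB/= [in X in _ = _ + X]linearZ/= addrA subrK.
have xb : `|x u - x t| <= (1 + `|l|) * `|u - t|.
  rewrite -(subrK ((u - t) *: l) (x u - x t)); apply: le_trans (ler_normD _ _) _.
  rewrite mulrDl [in leRHS](mulrC `|l|) -normrZ lerD//.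
  by apply: le_trans xo _; rewrite ler_wpM2r// ge_min lexx orbT.
have xo' : `|x u - x t - (u - t) *: l| <= c * `|u - t|.
  by apply: le_trans xo _; rewrite ler_wpM2r// ge_min lexx.
apply: le_trans (ler_normD _ _) _.
apply: (@le_trans _ _ (c * ((1 + `|l|) * `|u - t|) + M * (c * `|u - t|))).
  apply: lerD; first by apply: le_trans go _; rewrite ler_wpM2l// ltW.
  by apply: le_trans (gM _) _; rewrite ler_wpM2l// ltW.
rewrite le_eqVlt; apply/orP; left; apply/eqP.
rewrite /c; field; lra.
Qed.

(** Derivatives only see the germ of a function in the interval; this is what
allows a function on the manifold to be replaced by its expression in a chart,
which is meaningful only while the curve stays in the domain. *)
Lemma is_derive_in_near F I J (f g : R -> F) t l :
  (\forall u \near within I t^', J u /\ f u = g u) -> f t = g t ->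
  is_derive_in J g t l -> is_derive_in I f t l.
Proof.
move=> fg fgt /cvgrPdist_le gl; apply/cvgrPdist_le => e e0.
have := gl _ e0; rewrite !near_withinE in fg *.
apply: filterS2 fg => u fg gu ut Iu; have [Ju fgu] := fg ut Iu.
by have := gu ut Ju; rewrite /diff_quot fgu fgt.
Qed.

Lemma is_derive_in_cst F I (a : F) t : is_derive_in I (fun=> a) t 0.
Proof.
rewrite /is_derive_in /diff_quot.
under eq_cvg do rewrite subrr scaler0.
exact: cvg_cst.
Qed.

Lemma is_derive_inD F I (f g : R -> F) t a b :
  is_derive_in I f t a -> is_derive_in I g t b ->
  is_derive_in I (fun u => f u + g u) t (a + b).
Proof.
move=> fa gb; rewrite /is_derive_in.
have -> : diff_quot (fun u => f u + g u) t = diff_quot f t \+ diff_quot g t.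
  apply/funext => u; rewrite /diff_quot/= -scalerDr; congr (_ *: _).
  by rewrite opprD addrACA.
exact: cvgD fa gb.
Qed.

Lemma is_derive_in_sum F (J : Type) (r : seq J) I (f : J -> R -> F) t a :
  (forall j, is_derive_in I (f j) t (a j)) ->
  is_derive_in I (fun u => \sum_(j <- r) f j u) t (\sum_(j <- r) a j).
Proof.
move=> fa; elim: r => [|j r IH].
  rewrite big_nil.
  have -> : (fun u => \sum_(j <- [::]) f j u) = (fun=> 0).
    by apply/funext => u; rewrite big_nil.
  exact: is_derive_in_cst.
rewrite big_cons.
have -> : (fun u => \sum_(i <- j :: r) f i u) =
    (fun u => f j u + \sum_(i <- r) f i u).
  by apply/funext => u; rewrite big_cons.
exact: is_derive_inD.
Qed.

Lemma is_derive_inM I (f g : R -> R) t a b :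
  is_derive_in I f t a -> is_derive_in I g t b ->
  is_derive_in I (fun u => f u * g u) t (a * g t + f t * b).
Proof.
move=> fa gb.
rewrite /is_derive_in.
have -> : diff_quot (fun u => f u * g u) t =
    (fun u => diff_quot f t u * g u + f t * diff_quot g t u).
  by apply/funext => u; rewrite /diff_quot /= /GRing.scale /=; ring.
apply: cvgD; first exact: cvgM fa (is_derive_in_continuous gb).
exact: cvgM (cvg_cst (f t)) gb.
Qed.

(** This is what makes limits within [I], hence derivatives, unique. *)
Lemma within_interval_proper I t :
  proper_interval I -> I t -> ProperFilter (within I t^').
Proof.
move=> [Iint [a [b [Ia Ib ab]]]] It.
suff h e : 0 < e -> exists u, [/\ I u, u != t & `|t - u| < e].
  apply: Build_ProperFilter_ex => A.
  move=> /nbhs_ballP [e /= e0 tA].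
  by have [u [Iu ut tu]] := h _ e0; exists u; exact: (tA u).
move=> e0; have [tb|bt] := ltP t b.
  exists (t + Num.min (e / 2) (b - t)).
  have m0 : 0 < Num.min (e / 2) (b - t).
    by rewrite lt_min divr_gt0//= subr_gt0.
  split; last 1 first.
  - rewrite opprD addNKr normrN gtr0_norm// gt_min; apply/orP; left; lra.
  - apply: (Iint t b) => //; rewrite lerDl ltW//=.
    by rewrite -lerBrDl ge_min lexx orbT.
  - by rewrite -subr_eq0 addrAC subrr add0r gt_eqF.
have {bt}ta : a < t by exact: lt_le_trans bt.
exists (t - Num.min (e / 2) (t - a)).
have m0 : 0 < Num.min (e / 2) (t - a).
  by rewrite lt_min divr_gt0//= subr_gt0.
split.
- apply: (Iint a t) => //; rewrite andbC gerBl ltW//=.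
  by rewrite lerBrDr -lerBrDl ge_min lexx orbT.
- by rewrite -subr_eq0 addrAC subrr add0r oppr_eq0 gt_eqF.
- rewrite opprB addrC subrK gtr0_norm// gt_min; apply/orP; left; lra.
Qed.

Lemma is_derive_in_unique F I (f : R -> F) t a b :
  ProperFilter (within I t^') ->
  is_derive_in I f t a -> is_derive_in I f t b -> a = b.
Proof. by move=> Ip fa fb; apply: cvg_unique fa fb. Qed.

End DeriveIn.

(** * Directional derivatives and the symmetry of second derivatives *)

Section Directional.
Context {R : realType}.
Implicit Types (E F G : normedModType R).

Lemma derive_dir_linear E F (f : E -> F) x a u v :
  differentiable f x ->
  'D_(a *: u + v) f x = a *: 'D_u f x + 'D_v f x.
Proof. by move=> df; rewrite !deriveE// linearP. Qed.

Lemma derive_dirD E F (f : E -> F) x u v :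
  differentiable f x -> 'D_(u + v) f x = 'D_u f x + 'D_v f x.
Proof. by move=> df; rewrite !deriveE// linearD. Qed.

Lemma derive_comp E F G (f : E -> F) (g : F -> G) x v :
  differentiable f x -> differentiable g (f x) ->
  'D_v (g \o f) x = 'D_('D_v f x) g (f x).
Proof.
move=> df dg; rewrite !deriveE//; first by rewrite diff_comp.
exact: differentiable_comp.
Qed.

Lemma is_derive_line E F (f : E -> F) x u (s : R) :
  derivable f (x + s *: u) u ->
  is_derive s (1 : R) (fun r => f (x + r *: u)) ('D_u f (x + s *: u)).
Proof.
have e : (fun h : R => h^-1 *: (((fun r => f (x + r *: u)) \o shift s) (h *: 1)
     - f (x + s *: u))) =
   (fun h => h^-1 *: ((f \o shift (x + s *: u)) (h *: u) - f (x + s *: u))).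
  apply/funext => h /=; congr (_ *: (f _ - _)).
  by rewrite [h *: 1]mulr1 scalerDl addrCA.
by move=> df; split; rewrite /derivable /derive e.
Qed.

Lemma mvt_segment E (f : E -> R) x u (h : R) : 0 < h ->
  (forall s, 0 <= s <= h -> differentiable f (x + s *: u)) ->
  exists2 s, 0 <= s <= h & f (x + h *: u) - f x = h * 'D_u f (x + s *: u).
Proof.
move=> h0 df.
pose p (s : R) := f (x + s *: u).
have dp (s : R) : 0 <= s <= h -> is_derive s (1 : R) p ('D_u f (x + s *: u)).
  by move=> sh; apply: is_derive_line; apply: diff_derivable; exact: df.
have [||s] := @MVT R p (fun s => 'D_u f (x + s *: u)) 0 h h0.
- move=> s; rewrite in_itv/= => /andP[s0 sh]; apply: dp.
  by rewrite !ltW.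
- apply: derivable_within_continuous => s; rewrite in_itv/= => sh.
  by have [] := dp _ sh.
rewrite in_itv/= => /andP[s0 sh]; rewrite /p scale0r addr0 subr0 mulrC => e.
by exists s; rewrite ?ltW.
Qed.

(** The mean value theorem, applied first in the direction [u] to
[f (y + h *: v) - f y] and then in the direction [v] to ['D_u f]. *)
Lemma second_difference E (f : E -> R) x u v (h : R) : 0 < h ->
  (forall s t, 0 <= s <= h -> 0 <= t <= h ->
    differentiable f (x + s *: u + t *: v) /\
    differentiable (fun y => 'D_u f y) (x + s *: u + t *: v)) ->
  exists s t, [/\ 0 <= s <= h, 0 <= t <= h &
    f (x + h *: u + h *: v) - f (x + h *: u) - (f (x + h *: v) - f x) =
    h ^+ 2 * 'D_v (fun y => 'D_u f y) (x + s *: u + t *: v)].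
Proof.
move=> h0 df.
have l0 : 0 <= (0 : R) <= h by rewrite lexx ltW.
have lh : 0 <= h <= h by rewrite lexx ltW.
pose g y := f (y + h *: v) - f y.
have dshift y : differentiable (fun z => z + h *: v) y.
  exact: differentiableD.
have df0 s : 0 <= s <= h -> differentiable f (x + s *: u).
  by move=> sh; have [] := df _ 0 sh l0; rewrite scale0r addr0.
have dfh s : 0 <= s <= h ->
    differentiable (fun y => f (y + h *: v)) (x + s *: u).
  move=> sh; apply: (@differentiable_comp _ _ _ _ (fun z => z + h *: v) f) => //.
  by have [] := df _ h sh lh.
have [s sh gE] : exists2 s, 0 <= s <= h &
    g (x + h *: u) - g x = h * 'D_u g (x + s *: u).
  apply: mvt_segment => // s sh; apply: differentiableB; first exact: dfh.
  exact: df0.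
have [t th DE] : exists2 t, 0 <= t <= h &
    'D_u f (x + s *: u + h *: v) - 'D_u f (x + s *: u) =
    h * 'D_v (fun y => 'D_u f y) (x + s *: u + t *: v).
  by apply: mvt_segment => // t th; have [] := df s t sh th.
exists s, t; split=> //.
rewrite -[LHS]/(g (x + h *: u) - g x) gE expr2 -mulrA -DE.
congr (_ * _); rewrite /g deriveB; last 2 first.
- by apply: diff_derivable; exact: dfh.
- by apply: diff_derivable; exact: df0.
congr (_ - _).
rewrite (@derive_comp _ _ _ (fun z => z + h *: v) f)//; last first.
  by have [] := df _ h sh lh.
congr ('D_ _ _ _).
rewrite deriveD//= ?derive_id ?derive_cst ?addr0//.
Qed.

Lemma near_parallelogram E (x u v : E) (P : set E) :
  (\forall y \near x, P y) ->
  exists2 h : R, 0 < h & forall s t, 0 <= s <= h -> 0 <= t <= h ->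
    P (x + s *: u + t *: v).
Proof.
move=> /nbhs_normP [r /= r0 xP].
pose d : R := 1 + `|u| + `|v|.
have d0 : 0 < d by rewrite ltr_pwDl// ltr_pwDl.
exists (r / d) => [|s t /andP[s0 sh] /andP[t0 th]]; first exact: divr_gt0.
apply: xP => /=; rewrite -addrA opprD addNKr normrN.
apply: le_lt_trans (ler_normD _ _) _; rewrite !normrZ !ger0_norm//.
apply: (@le_lt_trans _ _ (r / d * (`|u| + `|v|))).
  by rewrite mulrDr lerD// ler_wpM2r.
rewrite mulrAC ltr_pdivrMr// ltr_pM2l// /d; lra.
Qed.

(** Schwarz: the second difference is symmetric in [u] and [v], and divided by
[h ^+ 2] it is a value near [x] of either mixed derivative, both of which are
continuous. *)
Lemma derive_sym E (f : E -> R) (U : set E) x u v :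
  open U -> Ck 2 U f -> U x ->
  'D_u (fun y => 'D_v f y) x = 'D_v (fun y => 'D_u f y) x.
Proof.
move=> Uo [df ddf] Ux.
have Un : \forall y \near x, U y by exact: open_nbhs_nbhs.
have cuv : {for x, continuous (fun y => 'D_u (fun z => 'D_v f z) y)}.
  exact: (ddf v).2.
have cvu : {for x, continuous (fun y => 'D_v (fun z => 'D_u f z) y)}.
  exact: (ddf u).2.
apply/eqP; rewrite -subr_eq0 -normr_le0; apply/ler_addgt0Pl => e e0; rewrite addr0.
have e20 : 0 < e / 2 by rewrite divr_gt0.
have nearc (g : E -> R) : {for x, continuous g} ->
    \forall y \near x, U y /\ `|g x - g y| <= e / 2.
  by move=> /cvgrPdist_le/(_ _ e20) cg; apply: filterS2 Un cg.
have [h1 h10 P1] := near_parallelogram u v (nearc _ cvu).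
have [h2 h20 P2] := near_parallelogram v u (nearc _ cuv).
pose h := Num.min h1 h2.
have h0 : 0 < h by rewrite lt_min h10.
have hh1 s : 0 <= s <= h -> 0 <= s <= h1.
  by move=> /andP[-> /le_trans]; apply; rewrite ge_min lexx.
have hh2 s : 0 <= s <= h -> 0 <= s <= h2.
  by move=> /andP[-> /le_trans]; apply; rewrite ge_min lexx orbT.
have [s t /hh1 sh /hh1 th|s [t [sh th E1]]] :=
    @second_difference _ f x u v h h0.
  by have [Us _] := P1 _ _ sh th; split; [exact: df|exact: (ddf u).1].
have [s' t' /hh2 sh' /hh2 th'|s' [t' [sh' th' E2]]] :=
    @second_difference _ f x v u h h0.
  by have [Us' _] := P2 _ _ sh' th'; split; [exact: df|exact: (ddf v).1].
have [_ B1] := P1 _ _ (hh1 _ sh) (hh1 _ th).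
have [_ B2] := P2 _ _ (hh2 _ sh') (hh2 _ th').
have EE : 'D_v (fun z => 'D_u f z) (x + s *: u + t *: v) =
          'D_u (fun z => 'D_v f z) (x + s' *: v + t' *: u).
  apply: (@mulfI _ (h ^+ 2)); first by rewrite expf_neq0// gt_eqF.
  rewrite -E1 -E2 [x + h *: v + h *: u]addrAC; ring.
rewrite EE distrC in B1.
rewrite (le_trans (ler_distD ('D_u (fun z => 'D_v f z) (x + s' *: v + t' *: u)) _ _))//.
by rewrite [leRHS]splitr lerD.
Qed.

End Directional.

(** * Derivative along a curve in a moving direction *)

Section DeriveAlong.
Context {R : realType}.
Implicit Types (E F : normedModType R).

(** Only the directional derivatives of ['D_u f] are given by [Ck], so its
linearity in [u], which holds on the open set, has to be differentiated. *)
Lemma derive2_dir_linear E (f : E -> R) (U : set E) x w a u v :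
  open U -> Ck 2 U f -> U x ->
  'D_w (fun y => 'D_(a *: u + v) f y) x =
  a * 'D_w (fun y => 'D_u f y) x + 'D_w (fun y => 'D_v f y) x.
Proof.
move=> Uo [df ddf] Ux.
rewrite (@near_eq_derive _ _ _ _
    (a \*: (fun y => 'D_u f y) + (fun y => 'D_v f y))); last first.
  have : \forall y \near x, U y by exact: open_nbhs_nbhs.
  by apply: filterS => y /df dfy; rewrite derive_dir_linear.
have du z : derivable (fun y => 'D_z f y) x w.
  by apply: diff_derivable; exact: (ddf z).1.
by rewrite deriveD ?deriveZ//; apply: derivableZ.
Qed.

Lemma derive2_dir_sum E (f : E -> R) (U : set E) x w
    (J : Type) (r : seq J) (a : J -> R) (e : J -> E) :
  open U -> Ck 2 U f -> U x ->
  'D_w (fun y => 'D_(\sum_(j <- r) a j *: e j) f y) x =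
  \sum_(j <- r) a j * 'D_w (fun y => 'D_(e j) f y) x.
Proof.
move=> Uo f2 Ux; elim: r => [|j r IH]; last first.
  by rewrite !big_cons (derive2_dir_linear _ _ _ _ Uo) ?IH.
rewrite !big_nil -[RHS](derive_cst (0 : R) x w); congr ('D_ _ _ _).
by apply/funext => y; rewrite derive0.
Qed.

Lemma derive_dir_sum E F (f : E -> F) x (J : Type) (r : seq J) (a : J -> R)
    (e : J -> E) : differentiable f x ->
  'D_(\sum_(j <- r) a j *: e j) f x = \sum_(j <- r) a j *: 'D_(e j) f x.
Proof.
move=> df; rewrite deriveE// linear_sum; apply: eq_bigr => j _.
by rewrite linearZ/= deriveE.
Qed.

Lemma derive_coord m n (A B : 'M[R]_(m, n)) i j :
  'D_A (fun N : 'M[R]_(m, n) => N i j : R) B = A i j.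
Proof.
rewrite /derive; apply: lim_near_cst => //=.
near=> h; rewrite !mxE addrK [_ *: _]mulrA mulVf ?mul1r//.
by near: h; exact: nbhs_dnbhs_neq.
Unshelve. all: by end_near. Qed.

(** The Leibniz rule for the derivative of [f] in a direction that moves with
its base point. Expanding the direction in the canonical basis reduces it to
products of real functions. *)
Lemma is_derive_in_dir n (f : 'rV[R]_n -> R) (U : set 'rV[R]_n) (I : set R)
    (x V : R -> 'rV[R]_n) t dx dV :
  open U -> Ck 2 U f -> U (x t) ->
  is_derive_in I x t dx -> is_derive_in I V t dV ->
  is_derive_in I (fun s => 'D_(V s) f (x s)) t
    ('D_dV f (x t) + 'D_dx (fun y => 'D_(V t) f y) (x t)).
Proof.
move=> Uo f2 Ux xdx VdV; have [df ddf] := f2.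
apply: (@is_derive_in_near _ _ I I _
  (fun s => \sum_(j < n) V s 0 j * 'D_(delta_mx 0 j) f (x s))).
- have xU : \forall s \near within I t^', U (x s).
    by apply: (is_derive_in_continuous xdx); exact: open_nbhs_nbhs.
  rewrite !near_withinE in xU *; apply: filterS xU => s xU st Is; split=> //.
  by rewrite {1}(row_sum_delta (V s)) derive_dir_sum//; apply: df; exact: xU.
- by rewrite {1}(row_sum_delta (V t)) derive_dir_sum//; exact: df.
- rewrite (row_sum_delta dV) (row_sum_delta (V t)) derive_dir_sum; last exact: df.
  rewrite (derive2_dir_sum _ _ _ _ Uo)// -big_split/=.
  apply: is_derive_in_sum => j.
  apply: is_derive_inM.
    rewrite -[X in is_derive_in _ _ _ X](derive_coord dV (V t) 0 j).
    apply: (is_derive_in_comp (g := fun N : 'rV[R]_n => N 0 j : R)) => //.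
    exact: differentiable_coord.
  apply: (is_derive_in_comp (g := fun y => 'D_(delta_mx 0 j) f y)) => //.
  exact: (ddf _).1.
Qed.

End DeriveAlong.

(** * Differentials and gradients in charts *)

Section Chart.
Context {R : realType} {E : normedModType R} {M : metricAtlas E}.
Hypothesis sM : smooth_manifold M.
Implicit Types (c d : chart M) (p : M).

Lemma near_chart c d p : dom c p -> dom d p ->
  \forall y \near coord c p,
    [/\ dom c (point c y), dom d (point c y) & coord c (point c y) = y].
Proof.
move=> cp dp.
have imc : chart_im c (coord c p) by exists p.
have imn : \forall y \near coord c p, chart_im c y.
  by apply: open_nbhs_nbhs; split => //; exact: (chart_im_open sM).
have dn : \forall y \near coord c p, dom d (point c y).
  apply: (point_continuous sM imc); rewrite (coordK sM cp).
  by apply: open_nbhs_nbhs; split => //; exact: (dom_open sM).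
apply: filterS2 imn dn => _ [q cq <-] dq.
by split => //; rewrite (coordK sM cq).
Qed.

(** A curve stays in a chart for a while, which is what makes computations
in a single chart sufficient to find derivatives. *)
Lemma near_curve_dom I (al : R -> M) c t :
  {within I, continuous al} -> I t -> dom c (al t) ->
  \forall s \near within I t^', I s /\ dom c (al s).
Proof.
move=> /subspace_continuousP cal It ct.
have : \forall s \near within I (nbhs t), dom c (al s).
  apply: (cal t It); apply: open_nbhs_nbhs; split => //; exact: (dom_open sM).
rewrite !near_withinE => h; apply: filterS h => s h _ Is; split => //; exact: h.
Qed.

Lemma transition_coord c d p : dom c p -> transition c d (coord c p) = coord d p.
Proof. by move=> cp; rewrite /transition (coordK sM cp). Qed.

Lemma differentiable_transition c d p : dom c p -> dom d p ->
  differentiable (transition c d) (coord c p).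
Proof.
move=> cp dp; have [+ _] := transition_smooth sM c d 1.
by apply; exists p.
Qed.

Lemma derive_transition (F : normedModType R) (f : M -> F) c d p u :
  dom c p -> dom d p -> differentiable (f \o point d) (coord d p) ->
  'D_u (f \o point c) (coord c p) =
  'D_('D_u (transition c d) (coord c p)) (f \o point d) (coord d p).
Proof.
move=> cp dp df.
rewrite -[in RHS](transition_coord d cp) -derive_comp; last 2 first.
- exact: differentiable_transition.
- by rewrite transition_coord.
apply: near_eq_derive; apply: filterS (near_chart cp dp) => y [_ dy _] /=.
by rewrite /transition (coordK sM dy).
Qed.

(** Every vector of the model space represents a tangent vector: this is how
the intrinsic hypotheses on tangent vectors are brought into a chart. *)
Definition tvec_of c p (u : E) : tvec M :=
  fun d => 'D_u (transition c d) (coord c p).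

Lemma tvec_ofK c p u : dom c p -> tvec_of c p u c = u.
Proof.
move=> cp; rewrite /tvec_of -[RHS](derive_id (coord c p) u).
by apply: near_eq_derive; apply: filterS (near_chart cp cp) => y [].
Qed.

Lemma tangent_tvec_of c p u : dom c p -> tangent p (tvec_of c p u).
Proof.
move=> cp d e dp ep; rewrite /tvec_of.
exact: (derive_transition (f := coord e) u cp dp (differentiable_transition dp ep)).
Qed.

Variable f : M -> R.
Hypothesis sf : smooth_fun f.

Lemma smooth_fun_differentiable c p : dom c p ->
  differentiable (f \o point c) (coord c p).
Proof. by move=> cp; have [+ _] := sf c 1; apply; exists p. Qed.

Lemma dfun_chart c p v : tangent p v -> dom c p ->
  dfun f p v = 'D_(v c) (f \o point c) (coord c p).
Proof.
move=> tv cp; have p0 := chart_at_dom sM p.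
rewrite /dfun /= (tv c (chart_at p)) //.
rewrite -derive_transition//; exact: smooth_fun_differentiable.
Qed.

(** [inner] uses the preferred chart of the point, which varies along a curve;
the right-hand side is available in a chart that does not. *)
Lemma inner_gradient G c p v : is_gradient f G -> tangent p v -> dom c p ->
  inner p (G p) v = 'D_(v c) (f \o point c) (coord c p).
Proof. by move=> /(_ p)[_ Gp] tv cp; rewrite -Gp// -dfun_chart. Qed.

Lemma metric_gradient G p u : is_gradient f G ->
  let c := chart_at p in
  metric c (coord c p) (G p c) u = 'D_u (f \o point c) (coord c p).
Proof.
move=> fG c; have cp : dom c p := chart_at_dom sM p.
have := inner_gradient fG (tangent_tvec_of u cp) cp.
by rewrite /inner -/c tvec_ofK.
Qed.

End Chart.

(** * Polarization of the Christoffel symbols *)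

Section Christoffel.
Context {R : realType} {E : normedModType R} {M : metricAtlas E}.
Hypothesis rM : riemannian_manifold M.
Variables (c : chart M) (x : E).
Hypothesis cx : chart_im c x.
Implicit Types u v w : E.

Lemma metricDl u v w :
  metric c x (u + v) w = metric c x u w + metric c x v w.
Proof. by have := metric_linear rM cx 1 u v w; rewrite scale1r mul1r. Qed.

Lemma metricDr u v w :
  metric c x w (u + v) = metric c x w u + metric c x w v.
Proof. by rewrite !(metric_sym rM cx w) metricDl. Qed.

Lemma metric0l w : metric c x 0 w = 0.
Proof.
have := metricDl 0 0 w; rewrite addr0 => /eqP.
by rewrite -subr_eq0 opprD addrA subrr add0r oppr_eq0 => /eqP.
Qed.

Lemma metricZl a u w : metric c x (a *: u) w = a * metric c x u w.
Proof.
by rewrite -[a *: u]addr0 (metric_linear rM cx) metric0l addr0.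
Qed.

Lemma metricNl u w : metric c x (- u) w = - metric c x u w.
Proof. by rewrite -scaleN1r metricZl mulN1r. Qed.

Lemma metric_suml (J : Type) (r : seq J) (u : J -> E) w :
  metric c x (\sum_(j <- r) u j) w = \sum_(j <- r) metric c x (u j) w.
Proof.
elim: r => [|j r IH]; first by rewrite !big_nil metric0l.
by rewrite !big_cons metricDl IH.
Qed.

End Christoffel.

Section Polarization.
Context {R : realType} {E : normedModType R} {M : metricAtlas E}.
Hypothesis rM : riemannian_manifold M.
Variables (c : chart M) (x : E).
Hypothesis cx : chart_im c x.
Implicit Types u v w z : E.

Let near_im : \forall y \near x, chart_im c y.
Proof. by apply: open_nbhs_nbhs; split => //; exact: (chart_im_open rM). Qed.

Let diff_metric u v : differentiable (fun y => metric c y u v) x.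
Proof. by have [+ _] := metric_smooth rM c u v 1; apply. Qed.

Lemma derive_metricDl u v w z :
  'D_z (fun y => metric c y (u + v) w) x =
  'D_z (fun y => metric c y u w) x + 'D_z (fun y => metric c y v w) x.
Proof.
rewrite -deriveD; [|exact: diff_derivable..].
by apply: near_eq_derive; apply: filterS near_im => y cy; rewrite metricDl.
Qed.

Lemma derive_metricC u v z :
  'D_z (fun y => metric c y u v) x = 'D_z (fun y => metric c y v u) x.
Proof.
apply: near_eq_derive; apply: filterS near_im => y cy.
exact: (metric_sym rM cy).
Qed.

Lemma christoffel_polarization u v w :
  christoffel c x (u + v) (u + v) w =
  christoffel c x u u w + christoffel c x v v w + 2 * christoffel c x u v w.
Proof.
rewrite /christoffel !derive_dirD//.
rewrite !derive_metricDl !(derive_metricC _ (u + v)) !derive_metricDl.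
rewrite (derive_metricC v u); lra.
Qed.

End Polarization.

(** * The Hessian of an affine function *)

Section AffineHessian.
Context {R : realType} {n : nat} {M : metricAtlas 'rV[R]_n}.
Hypothesis rM : riemannian_manifold M.
Hypothesis cM : geodesically_complete M.
Variables (f : M -> R) (G : M -> tvec M).
Hypotheses (sf : smooth_fun f) (af : affine_fun f) (fG : is_gradient f G).

Let F c : 'rV[R]_n -> R := f \o point c.

Lemma proper_setT : proper_interval [set: R].
Proof.
split; first by move=> *.
by exists 0, 1; split => //; exact: ltr01.
Qed.

(** Differentiate twice the affine function [f \o ga], where [ga] is the
geodesic with initial velocity [u]. *)
Lemma affine_hessian_diag p u : let c := chart_at p in
  'D_u (fun y => 'D_u (F c) y) (coord c p) =
  christoffel c (coord c p) u u (G p c).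
Proof.
move=> c; have cp : dom c p := chart_at_dom rM p.
have properT (t : R) : ProperFilter (within setT t^').
  exact: within_interval_proper proper_setT I.
have [ga [geo ga0 vel]] := cM (tangent_tvec_of rM u cp).
have [a [b fga]] := af proper_setT geo.
case: geo => -[cga _] [v hv].
have c0 : dom c (ga 0) by rewrite ga0.
have [vel0 /(_ c c0)[dx [dV [Xdx VdV geoE]]]] := hv 0 I.
pose X s := coord c (ga s).
have uE : dx = u.
  by rewrite -(tvec_ofK rM u cp); exact: is_derive_in_unique Xdx (vel c c0).
have vE : v 0 c = u.
  by rewrite -uE; exact: is_derive_in_unique (vel0 c c0) Xdx.
have dF s : dom c (ga s) -> 'D_(v s c) (F c) (X s) = a.
  move=> cs; apply: (is_derive_in_unique (properT s)).
    apply: (is_derive_in_comp (I := setT) (x := X)).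
      exact: smooth_fun_differentiable.
    exact: (hv s I).1.
  apply: (@is_derive_in_near _ _ setT setT _ (fun r => a * r + b)).
  - apply: filterS (near_curve_dom rM cga I cs) => r [_ cr]; split => //=.
    by rewrite /F /X/= (coordK rM cr) fga.
  - by rewrite /F /X/= (coordK rM cs) fga.
  - apply/is_derive_in_littleo => e e0; apply: nearW => r.
    have -> : a * r + b - (a * s + b) - (r - s) *: (a : R^o) = 0.
      rewrite -[(r - s) *: _]/((r - s) * a); ring.
    by rewrite normr0 mulr_ge0 // ltW.
have dF0 : is_derive_in setT (fun s => 'D_(v s c) (F c) (X s)) 0 0.
  apply: (@is_derive_in_near _ _ setT setT _ (fun=> a)).
  - by apply: filterS (near_curve_dom rM cga I c0) => r [_ cr]; rewrite dF.
  - by rewrite dF.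
  - exact: is_derive_in_cst.
have imX : chart_im c (X 0) by exists (ga 0).
(* Two values of the derivative at 0 of the constant function
   s |-> DF(x'(s)). *)
have := is_derive_in_unique (properT 0) dF0
  (is_derive_in_dir (chart_im_open rM c) (sf c 2) imX Xdx VdV).
rewrite uE vE /X ga0 -(metric_gradient rM sf p dV fG) -/c.
move: geoE; rewrite uE vE ga0 => geoE /esym/eqP.
have cxp : chart_im c (coord c p) by exists p.
rewrite addrC addr_eq0 => /eqP ->; rewrite -geoE sub0r (metricNl rM)//.
by rewrite (metric_sym rM).
Qed.

(** Polarization; the Hessian is symmetric by [derive_sym]. *)
Lemma affine_hessian p u v : let c := chart_at p in
  'D_u (fun y => 'D_v (F c) y) (coord c p) =
  christoffel c (coord c p) u v (G p c).
Proof.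
move=> c; have cp : dom c p := chart_at_dom rM p.
have cx : chart_im c (coord c p) by exists p.
have Uo := chart_im_open rM c.
have F2 : Ck 2 (chart_im c) (F c) := sf c 2.
have /= := affine_hessian_diag p (u + v); rewrite -/c (christoffel_polarization rM)//.
rewrite derive_dirD; last exact: (F2.2 _).1.
have DD z : 'D_z (fun y => 'D_(u + v) (F c) y) (coord c p) =
    'D_z (fun y => 'D_u (F c) y) (coord c p) +
    'D_z (fun y => 'D_v (F c) y) (coord c p).
  by have := derive2_dir_linear z 1 u v Uo F2 cx; rewrite scale1r mul1r.
rewrite !DD (derive_sym v u Uo F2 cx) !affine_hessian_diag -/c; lra.
Qed.

End AffineHessian.

(** * The gradient along a curve *)

Section AlongCurve.
Context {R : realType} {n : nat} {M : metricAtlas 'rV[R]_n}.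
Hypothesis rM : riemannian_manifold M.
Implicit Types p : M.

Lemma innerDZr p (v w1 w2 : tvec M) (a b : R) :
  inner p v (fun c => a *: w1 c + b *: w2 c) =
  a * inner p v w1 + b * inner p v w2.
Proof.
have cx : chart_im (chart_at p) (coord (chart_at p) p).
  by exists p; first exact: (chart_at_dom rM).
rewrite /inner (metricDr rM cx); congr (_ + _);
  by rewrite !(metric_sym rM cx (v _)) (metricZl rM cx).
Qed.

(** The gradient of an affine function is parallel. In a chart the derivative
is DF(V') + D_x' D_V F; the Hessian formula turns the second term into
Gamma(x', V, G) = g(W - V', G), and DF(V') = g(V', G). *)
Lemma gradient_component_derive (f : M -> R) (G : M -> tvec M) (I : set R)
    (al : R -> M) (V : R -> tvec M) (t : R) (W : tvec M) :
  geodesically_complete M -> smooth_fun f -> affine_fun f ->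
  is_gradient f G -> {within I, continuous al} -> I t ->
  (forall s, I s -> tangent (al s) (V s)) -> is_covder I al V t W ->
  is_derive_in I (fun s => inner (al s) (G (al s)) (V s)) t
    (inner (al t) (G (al t)) W).
Proof.
move=> cM sf af fG cal It tV covV; pose c := chart_at (al t).
have cp : dom c (al t) := chart_at_dom rM (al t).
have cx : chart_im c (coord c (al t)) by exists (al t).
have [dx [dV [Xdx VdV WE]]] := covV c cp.
have aE s : I s -> dom c (al s) -> inner (al s) (G (al s)) (V s) =
    'D_(V s c) (f \o point c) (coord c (al s)).
  by move=> Is cs; apply: (inner_gradient rM sf fG) => //; exact: tV.
apply: (@is_derive_in_near _ _ I I _
  (fun s => 'D_(V s c) (f \o point c) (coord c (al s)))).
- apply: filterS (near_curve_dom rM cal It cp) => s [Is cs].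
  by split => //; exact: aE.
- exact: aE.
have := is_derive_in_dir (chart_im_open rM c) (sf c 2) cx Xdx VdV.
rewrite (affine_hessian rM cM sf af fG) -/c -WE -(metric_gradient rM sf _ dV fG).
by rewrite -/c (metric_sym rM cx) -(metricDl rM cx) addrC subrK (metric_sym rM cx).
Qed.

(** The [n] orthonormal vectors are the rows of an invertible matrix since the
model space has dimension [n], so they span. *)
Lemma orthonormal_parseval p (e : nat -> tvec M) (v : tvec M) :
  (forall i j, (0 < i <= n)%N -> (0 < j <= n)%N ->
    inner p (e i) (e j) = (i == j)%:R) ->
  inner p v v = \sum_(1 <= i < n.+1) inner p v (e i) ^+ 2.
Proof.
rewrite /inner; set c := chart_at p => ee.
have cx : chart_im c (coord c p) by exists p; first exact: (chart_at_dom rM).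
pose A := \matrix_(i < n) e i.+1 c.
(* The coefficients of a combination of the rows are its inner products with
   them. *)
have coordE (y : 'rV[R]_n) (j : 'I_n) :
    metric c (coord c p) (y *m A) (e j.+1 c) = y 0 j.
  rewrite mulmx_sum_row (metric_suml rM cx) (bigD1 j)//= big1 ?addr0.
    by rewrite (metricZl rM cx) rowK ee ?ltn_ord// eqxx mulr1.
  move=> i ij; rewrite (metricZl rM cx) rowK ee ?ltn_ord//.
  by rewrite eqSS -val_eqE in ij *; rewrite (negbTE ij) mulr0.
have Aunit : A \in unitmx.
  rewrite -row_free_unit -kermx_eq0; apply/rowV0P => y /sub_kermxP yA.
  by apply/rowP => j; rewrite -coordE yA (metric0l rM cx) mxE.
rewrite big_add1 big_mkord -[X in metric _ _ X _](mulmxKV Aunit (v c)).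
rewrite mulmx_sum_row (metric_suml rM cx); apply: eq_bigr => j _.
rewrite (metricZl rM cx) rowK (metric_sym rM cx) expr2 -coordE.
by rewrite (mulmxKV Aunit).
Qed.

End AlongCurve.

(** * The recurrence satisfied by the components *)

Lemma harmonic_curvatureSS (R : realType) (I : set R) (k : nat -> R -> R) i t :
  harmonic_curvature I k i.+2 t =
  (k i.+3 t)^-1 * (derive_in I (harmonic_curvature I k i.+1) t
                   + k i.+2 t * harmonic_curvature I k i t).
Proof. by []. Qed.

Section Components.
Context {R : realType} {n : nat} (I : set R) (k a : nat -> R -> R) (b : R).
Hypothesis proper_I : proper_interval I.
Hypothesis k_gt0 : forall i t, (0 < i < n)%N -> I t -> 0 < k i t.
Hypothesis a_first : forall t, I t -> a 0%N t = 0.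
Hypothesis a_last : forall t, I t -> a n.+1 t = 0.
Hypothesis a1_const : forall t, I t -> a 1%N t = b.
Hypothesis a_derive : forall i t, (0 < i <= n)%N -> I t ->
  is_derive_in I (a i) t (- k i.-1 t * a i.-1 t + k i t * a i.+1 t).

Lemma derive_in_component (c : R) (g : R -> R) i t : (0 < i <= n)%N -> I t ->
  (forall s, I s -> g s = c * a i s) ->
  is_derive_in I g t (c * (- k i.-1 t * a i.-1 t + k i t * a i.+1 t)).
Proof.
move=> i0 It ga; apply: (@is_derive_in_near _ _ I I _ (fun s => c * a i s)).
- by rewrite near_withinE; apply: nearW => s Is; split => //; exact: ga.
- exact: ga.
have := is_derive_inM (is_derive_in_cst I c t) (a_derive i0 It).
by rewrite mul0r add0r.
Qed.

(** The first component is constant, so the first equation reads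
[0 = k 1 t * a 2 t]. *)
Lemma component2_eq0 t : (2 <= n)%N -> I t -> a 2%N t = 0.
Proof.
move=> n2 It; have IP := within_interval_proper proper_I It.
have n1 : (0 < 1 <= n)%N by exact: ltnW.
have a1' : is_derive_in I (a 1%N) t 0.
  apply: (@is_derive_in_near _ _ I I _ (fun=> b)); last exact: is_derive_in_cst.
  - by rewrite near_withinE; apply: nearW => s Is; split => //; exact: a1_const.
  - exact: a1_const.
have := is_derive_in_unique IP (a_derive n1 It) a1'.
rewrite /= a_first// mulr0 add0r => /eqP; rewrite mulf_eq0 => /orP[|/eqP//].
by rewrite gt_eqF// k_gt0.
Qed.

(** Each equation determines the next component from the two before it, by the
recurrence of the harmonic curvatures. Its derivative term is why the
identity for [i.+1] has to be known on all of [I] before [i.+2]. *)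
Lemma component_harmonic i t : b != 0 -> (i.+2 <= n)%N -> I t ->
  a i.+2 t = b * harmonic_curvature I k i t.
Proof.
move=> b0.
(* The recurrence has order two, so two consecutive cases are carried. *)
suff h : (i.+2 <= n)%N ->
    (forall t, I t -> a i.+2 t = b * harmonic_curvature I k i t) /\
    ((i.+3 <= n)%N ->
     forall t, I t -> a i.+3 t = b * harmonic_curvature I k i.+1 t).
  by move=> /h[h' _]; exact: h'.
elim: i {t} => [|i IH] ni; split.
- by move=> t It; rewrite /= mulr0 component2_eq0.
- move=> n3 t It; have IP := within_interval_proper proper_I It.
  have a2' : is_derive_in I (a 2%N) t 0.
    apply: (@is_derive_in_near _ _ I I _ (fun=> 0)); last exact: is_derive_in_cst.
      rewrite near_withinE; apply: nearW => s Is; split => //.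
      exact: component2_eq0.
    exact: component2_eq0.
  have := is_derive_in_unique IP (a_derive (ni : 0 < 2 <= n)%N It) a2'.
  have k2 : k 2%N t != 0 by rewrite gt_eqF// k_gt0.
  rewrite /= a1_const// mulNr addrC => /eqP; rewrite subr_eq0 => /eqP k2a3.
  by rewrite mulrC -mulrA [_^-1 * b]mulrC mulrA -k2a3 mulrAC mulfV// mul1r.
- by move=> t It; have [_ ->] := IH (ltnW ni).
move=> n4 t It; have IP := within_interval_proper proper_I It.
have [Hi /(_ ni) HSi] := IH (ltnW ni).
have Hd : is_derive_in I (harmonic_curvature I k i.+1) t
    (b^-1 * (- k i.+2 t * a i.+2 t + k i.+3 t * a i.+4 t)).
  apply: (@derive_in_component b^-1 _ i.+3) => // s Is.
  by rewrite HSi// mulKf.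
have HdE : derive_in I (harmonic_curvature I k i.+1) t =
    b^-1 * (- k i.+2 t * a i.+2 t + k i.+3 t * a i.+4 t).
  exact: cvg_lim Hd.
have k3 : k i.+3 t != 0 by rewrite gt_eqF// k_gt0.
by rewrite harmonic_curvatureSS HdE Hi//; field; rewrite b0 k3.
Qed.

(** Each equation also determines the previous component from the two after
it: if the last one vanished on [I], so would all of them down to
[a 1 = b]. *)
Lemma last_component_neq0 : b != 0 -> (0 < n)%N ->
  exists t, I t /\ a n t != 0.
Proof.
move=> b0 n0; apply: contrapT => an.
have {}an t : I t -> a n t = 0.
  by move=> It; apply/eqP/negPn/negP => ant; apply: an; exists t.
have vanish j : (j < n)%N ->
    forall t, I t -> a (n - j)%N t = 0 /\ a (n - j).+1 t = 0.
  elim: j => [_ t It|j IH jn t It]; first by rewrite subn0 an// a_last.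
  have {}IH := IH (ltnW jn).
  have nj : (n - j = (n - j.+1).+1)%N by rewrite subnS prednK// subn_gt0 ltnW.
  have r0 : (0 < n - j.+1)%N by rewrite subn_gt0.
  have rn : (n - j.+1 < n)%N by rewrite ltn_subrL.
  rewrite {}nj in IH; set r := (n - j.+1)%N in r0 rn IH *.
  split; last by have [] := IH t It.
  have IP := within_interval_proper proper_I It.
  have ar' : is_derive_in I (a r.+1) t 0.
    apply: (@is_derive_in_near _ _ I I _ (fun=> 0)); last exact: is_derive_in_cst.
      rewrite near_withinE; apply: nearW => s Is; split => //.
      by have [] := IH s Is.
    by have [] := IH t It.
  (* Equation [r.+1], where [a r.+1] and [a r.+2] are known to vanish. *)
  have := is_derive_in_unique IP (a_derive (rn : 0 < r.+1 <= n)%N It) ar'.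
  have [_ ->] := IH t It; rewrite mulr0 addr0 mulNr => /eqP.
  rewrite oppr_eq0 mulf_eq0 => /orP[|/eqP//].
  by rewrite gt_eqF// k_gt0// r0.
have [_ [t [_ [It _ _]]]] := proper_I.
have [] := vanish n.-1 _ t It; first by rewrite prednK.
by rewrite -subn1 subKn// a1_const// => /eqP; rewrite (negbTE b0).
Qed.

End Components.

(** * Harmonic curvatures of an eikonal helix *)

Theorem theorem3p3 (R : realType) (n : nat) (M : metricAtlas 'rV[R]_n)
    (f : M -> R) (I : set R) (al : R -> M)
    (V : nat -> R -> tvec M) (k : nat -> R -> R) :
  (3 <= n)%N ->
  riemannian_manifold M ->
  connected [set: M] ->
  geodesically_complete M ->
  (exists N : metricAtlas 'rV[R]_n.-1,
     riemannian_manifold N /\ isometric M (riemannian_product N (real_line R))) ->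
  smooth_fun f ->
  affine_fun f ->
  ~ (exists a : R, forall p : M, f p = a) ->
  frenet_curve n I al V k ->
  eikonal_helix I f al (V 1%N) ->
  (exists t, I t /\ harmonic_curvature I k (n - 2) t != 0) /\
  (exists a : R, a != 0 /\
     forall t, I t ->
       \sum_(1 <= i < n.-1) harmonic_curvature I k i t ^+ 2 = a).
Proof.
move=> n3 rM _ cM _ sf af _ fr [G [fG [[r Gr] [b [b0 Gb]]]]].
have [pI [cal _] tV onV _ V0 Vn k_gt0 frE] := fr.
pose a i t := inner (al t) (G (al t)) (V i t).
have a_zero i t : (forall c, V i t c = 0) -> a i t = 0.
  move=> Vi; have cx : chart_im (chart_at (al t)) (coord (chart_at (al t)) (al t)).
    by exists (al t); first exact: (chart_at_dom rM).
  by rewrite /a /inner Vi (metric_sym rM cx) (metric0l rM cx).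
have a_first t : I t -> a 0%N t = 0 by move=> _; exact: a_zero.
have a_last t : I t -> a n.+1 t = 0 by move=> _; exact: a_zero.
have a_derive i t : (0 < i <= n)%N -> I t ->
    is_derive_in I (a i) t (- k i.-1 t * a i.-1 t + k i t * a i.+1 t).
  move=> i0 It; rewrite -(innerDZr rM).
  apply: (gradient_component_derive rM cM sf af fG cal It) => [s Is|].
    exact: tV.
  exact: frE.
have aH i t : (i.+2 <= n)%N -> I t -> a i.+2 t = b * harmonic_curvature I k i t.
  exact: (component_harmonic pI k_gt0 a_first Gb a_derive).
have n0 : (0 < n)%N by exact: leq_trans n3.
split.
  have [t [It ant]] := last_component_neq0 pI k_gt0 a_last Gb a_derive b0 n0.
  exists t; split => //; apply: contraNneq ant => Hn.
  have -> : n = (n - 2).+2 by rewrite -addn2 subnK// ltnW.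
  by rewrite aH ?Hn ?mulr0// -addn2 subnK// ltnW.
have HS t : I t ->
    \sum_(1 <= i < n.-1) harmonic_curvature I k i t ^+ 2 = r ^+ 2 / b ^+ 2 - 1.
  move=> It; have p_im : chart_im (chart_at (al t)) (coord (chart_at (al t)) (al t)).
    by exists (al t); first exact: (chart_at_dom rM).
  have r2 : r ^+ 2 = \sum_(1 <= i < n.+1) a i t ^+ 2.
    rewrite /a -(orthonormal_parseval rM); last by move=> i j *; exact: onV.
    rewrite -(Gr t It) sqr_sqrtr// /inner; set w := G _ _.
    have [->|w0] := eqVneq w 0; first by rewrite (metric0l rM p_im).
    by rewrite ltW// (metric_pos rM p_im).
  (* [a 2] vanishes, so the components from the third on are the [b * H_i]. *)
  have sumE : \sum_(3 <= i < n.+1) a i t ^+ 2 =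
      b ^+ 2 * \sum_(1 <= i < n.-1) harmonic_curvature I k i t ^+ 2.
    rewrite (big_addn 1 n.+1 2) mulr_sumr.
    have -> : (n.+1 - 2 = n.-1)%N by rewrite subSS subn1.
    apply: eq_big_nat => i /andP[_ i_n]; rewrite addn2 aH ?exprMn//.
    by rewrite -ltn_predRL; exact: i_n.
  rewrite 2?big_ltn// in r2; last by rewrite ltnS ltnW.
  rewrite sumE [a 1%N t]Gb// [a 2%N t]aH ?(ltnW n3)//= mulr0 expr0n/= add0r in r2.
  by rewrite r2 mulrDl mulfV ?sqrf_eq0// mulrAC mulfV ?sqrf_eq0// mul1r addrAC subrr add0r.
exists (r ^+ 2 / b ^+ 2 - 1); split => //.
have [_ [t [_ [It _ _]]]] := pI; rewrite -(HS t It).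
(* The first term of the sum is [(k 1 t / k 2 t) ^+ 2]. *)
rewrite big_ltn; last by rewrite ltn_predRL.
rewrite gt_eqF// ltr_wpDr//; first by apply: sumr_ge0 => i _; exact: sqr_ge0.
by rewrite exprn_gt0// divr_gt0// k_gt0// (ltnW n3).
Qed.
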